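(* Let $M$ be a common meadow and let $I$ be an ideal of $M$ different from $M$. Let $K=\{z\in 0\cdot M\mid I\cap M_z=M_z\}$. Then the quotient $M/I$ is a pre-meadow with $\mathbf{a}$, and the map $\rho:M\to M/I$ defined by $$\rho(x)=\begin{cases}x+(I\cap M_{z}), & \text{if } x\in M_{z}\text{ and } z\notin K,\\ \mathbf{a}, & \text{otherwise}\end{cases}$$ is a homomorphism. Moreover, given a common meadow $N$ and a homomorphism $f:M\to N$ such that $0\cdot f(x)=f(x)$ for all $x\in I$, there exists a unique homomorphism $\widetilde f:M/I\to N$ such that $\widetilde f\circ\rho=f$.
   Context: A pre-meadow is a set $P$ with constants $0,1$, binary operations $+,\cdot$ and a unary operation $-$ such that for all $x,y,z\in P$: $(x+y)+z=x+(y+z)$; $x+y=y+x$; $x+0=x$; $x+(-x)=0\cdot x$; $(x\cdot y)\cdot z=x\cdot(y\cdot z)$; $x\cdot y=y\cdot x$; $1\cdot x=x$; $x\cdot(y+z)=x\cdot y+x\cdot z$; $-(-x)=x$; $0\cdot(x+y)=0\cdot x\cdot y$. Write $0\cdot P=\{0\cdot x\mid x\in P\}$ and $P_z=\{x\in P\mid 0\cdot x=z\}$ for $z\in 0\cdot P$; each $P_z$ is, with the restricted operations, a commutative ring with zero $z$ and identity $1+z$. A pre-meadow with $\mathbf{a}$ is a pre-meadow $P$ for which there is a unique $z\in 0\cdot P$ with $|P_z|=1$, denoted $\mathbf{a}$, and $x+\mathbf{a}=\mathbf{a}$ for all $x\in P$. A common meadow is a set $M$ with constants $0,1,\mathbf{a}$,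 operations $+,\cdot,-$ and a unary operation $(\cdot)^{-1}$ satisfying the first nine equations above together with, for all $x,y$: $x\cdot x^{-1}=1+0\cdot x^{-1}$; $(x\cdot y)^{-1}=x^{-1}\cdot y^{-1}$; $(1+0\cdot x)^{-1}=1+0\cdot x$; $0^{-1}=\mathbf{a}$; $x+\mathbf{a}=\mathbf{a}$. Every common meadow is a pre-meadow with $\mathbf{a}$. A homomorphism between common meadows (or pre-meadows with $\mathbf{a}$) is a map $f$ with $f(x+y)=f(x)+f(y)$, $f(x\cdot y)=f(x)\cdot f(y)$ and $f(1)=1$ (it is not required to commute with inverses). An ideal of a common meadow $M$ is a subset $I\subseteq M$ such that $0\in I$ and $-x,\ x+y,\ x\cdot r\in I$ whenever $x,y\in I$, $r\in M$. Then each $I\cap M_z$ is an ideal of the ring $M_z$. With $K=\{z\in 0\cdot M\mid I\cap M_z=M_z\}$, the quotient is $$M/I=\Big(\bigsqcup_{z\in 0\cdot M\setminus K}M_z/(I\cap M_z)\Big)\sqcup\{\mathbf{a}\}.$$ Its operations: for $x\in M_z$, $y\in M_{z'}$ with $z,z'\notin K$, $(x+I\cap M_z)+(y+I\cap M_{z'})=(x+y)+(I\cap M_{z\cdot z'})$ and $(x+I\cap M_z)\cdot(y+I\cap M_{z'})=(x\cdot y)+(I\cap M_{z\cdot z'})$ if $z\cdot z'\notin K$, and both are $\mathbf{a}$ if $z\cdot z'\in K$; any sum or product involving $\mathbf{a}$ is $\mathbf{a}$; $-(x+I\cap M_z)=(-x)+I\cap M_z$, $-\mathbf{a}=\mathbf{a}$;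 the zero and one are $0+I\cap M_0$ and $1+I\cap M_0$. *)

(* Defs.v *)
From mathcomp Require Import all_boot.
From mathcomp Require Import boolp classical_sets.

Set Implicit Arguments.
Unset Strict Implicit.
Unset Printing Implicit Defensive.

Local Open Scope classical_set_scope.

Declare Scope meadow_scope.
Delimit Scope meadow_scope with M.

Record meadowSig := MeadowSig {
  sort :> Type;
  zero : sort;
  one : sort;
  add : sort -> sort -> sort;
  mul : sort -> sort -> sort;
  opp : sort -> sort }.

Arguments zero {m}.
Arguments one {m}.

Notation "0" := zero : meadow_scope.
Notation "1" := one : meadow_scope.
Notation "x + y" := (add x y) : meadow_scope.
Notation "x * y" := (mul x y) : meadow_scope.
Notation "- x" := (opp x) : meadow_scope.

Local Open Scope meadow_scope.

(* The nine equations common to pre-meadows and common meadows. Since 0 * x  *)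
(* need not be 0, these are not (semi)rings.                                 *)
Record meadow_eqs (P : meadowSig) : Prop := MeadowEqs {
  maddA : forall x y z : P, (x + y) + z = x + (y + z);
  maddC : forall x y : P, x + y = y + x;
  maddx0 : forall x : P, x + 0 = x;
  maddN : forall x : P, x + - x = 0 * x;
  mmulA : forall x y z : P, (x * y) * z = x * (y * z);
  mmulC : forall x y : P, x * y = y * x;
  mmul1x : forall x : P, 1 * x = x;
  mmulDr : forall x y z : P, x * (y + z) = x * y + x * z;
  moppK : forall x : P, - (- x) = x }.

Definition pre_meadow (P : meadowSig) : Prop :=
  meadow_eqs P /\ forall x y : P, 0 * (x + y) = 0 * x * y.

Definition zeros (P : meadowSig) : set P := [set 0 * x | x in [set: P]].

Definition fiber (P : meadowSig) (z : P) : set P := [set x | 0 * x = z].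

Definition trivial_fiber (P : meadowSig) (z : P) : Prop :=
  zeros z /\ exists x, fiber z = [set x].

Definition pre_meadow_with_a (P : meadowSig) (a : P) : Prop :=
  [/\ pre_meadow P,
      unique (@trivial_fiber P) a &
      forall x : P, x + a = a].

Record commonMeadow := CommonMeadow {
  cm_sig :> meadowSig;
  bot : cm_sig;
  inv : cm_sig -> cm_sig;
  cm_eqs : meadow_eqs cm_sig;
  cm_mulV : forall x : cm_sig, x * inv x = 1 + 0 * inv x;
  cm_invM : forall x y : cm_sig, inv (x * y) = inv x * inv y;
  cm_inv1D : forall x : cm_sig, inv (1 + 0 * x) = 1 + 0 * x;
  cm_inv0 : inv 0 = bot;
  cm_addbot : forall x : cm_sig, x + bot = bot }.

Definition is_hom (P Q : meadowSig) (f : P -> Q) : Prop :=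
  [/\ forall x y, f (x + y) = f x + f y,
      forall x y, f (x * y) = f x * f y &
      f 1 = 1].

Record is_ideal (P : meadowSig) (I : set P) : Prop := IsIdeal {
  ideal0 : I 0;
  idealN : forall x, I x -> I (- x);
  idealD : forall x y, I x -> I y -> I (x + y);
  idealM : forall x r, I x -> I (x * r) }.

Section Quotient.
Variables (P : meadowSig) (I : set P).

(* The set K of the zeros whose whole fibre lies in I. *)
Definition full_zeros : set P :=
  [set z | zeros z /\ I `&` fiber z = fiber z].

Definition coset (z x : P) : set P := [set x + i | i in I `&` fiber z].

Definition fiber_cosets (z : P) : set (set P) := [set coset z x | x in fiber z].

(* The disjoint union, with [None] as the additional element a. *)
Definition quotient_sort : Type :=
  option {z : {z : P | zeros z /\ ~ full_zeros z} &
          {C : set P | fiber_cosets (sval z) C}}.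

Definition rho (x : P) : quotient_sort :=
  match pselect (full_zeros (0 * x)) with
  | left _ => None
  | right zNK =>
      Some (existT (fun z : {z : P | zeros z /\ ~ full_zeros z} =>
                      {C : set P | fiber_cosets (sval z) C})
        (exist _ (0 * x) (conj (imageT (mul 0) x) zNK))
        (exist _ (coset (0 * x) x)
           (ex_intro2 (fiber (0 * x)) _ x erefl erefl)))
  end.

Definition repr (z : {z : P | zeros z /\ ~ full_zeros z})
    (C : {C : set P | fiber_cosets (sval z) C}) : P :=
  sval (cid2 (svalP C)).

(* Operations act on chosen representatives. As 0 * (x + y) = 0 * (x * y) =  *)
(* (0 * x) * (0 * y), [rho] puts x + y and x * y in the fibre of index       *)
(* z * z', or sends them to a when that index is full. Independence of the   *)
(* representatives is [addq_rho], [mulq_rho] and [oppq_rho] below.           *)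
Definition addq (u v : quotient_sort) : quotient_sort :=
  match u, v with
  | Some (existT _ C), Some (existT _ D) => rho (repr C + repr D)
  | _, _ => None
  end.

Definition mulq (u v : quotient_sort) : quotient_sort :=
  match u, v with
  | Some (existT _ C), Some (existT _ D) => rho (repr C * repr D)
  | _, _ => None
  end.

Definition oppq (u : quotient_sort) : quotient_sort :=
  match u with
  | Some (existT _ C) => rho (- repr C)
  | None => None
  end.

Definition quotient : meadowSig :=
  MeadowSig (rho 0) (rho 1) addq mulq oppq.

Definition quotient_a : quotient := None.

End Quotient.

Section BasicEquations.
Variables (P : meadowSig) (E : meadow_eqs P).

Lemma mmulx1 (x : P) : x * 1 = x.
Proof. by rewrite (mmulC E) (mmul1x E). Qed.

Lemma madd0x (x : P) : 0 + x = x.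
Proof. by rewrite (maddC E) (maddx0 E). Qed.

Lemma mmulDl (x y z : P) : (x + y) * z = x * z + y * z.
Proof. by rewrite (mmulC E) (mmulDr E) !(mmulC E z). Qed.

Lemma mmul00 : (0 * 0 : P) = 0.
Proof.
rewrite -[LHS]madd0x -[X in X + _](mmul1x E 0) -mmulDl (maddx0 E).
exact: mmul1x E 0.
Qed.

Lemma mmul0A (x : P) : 0 * (0 * x) = 0 * x.
Proof. by rewrite -(mmulA E) mmul00. Qed.

Lemma mmul0M (x y : P) : 0 * (x * y) = (0 * x) * (0 * y).
Proof.
by rewrite -(mmulA E (0 * x)) (mmulC E (0 * x) 0) mmul0A (mmulA E).
Qed.

Lemma maddACA (x y z t : P) : (x + y) + (z + t) = (x + z) + (y + t).
Proof.
by rewrite !(maddA E) -(maddA E y) (maddC E y z) (maddA E z).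
Qed.

Lemma maddx0x (x : P) : x + 0 * x = x.
Proof. by rewrite -[X in X + _](mmul1x E x) -mmulDl (maddx0 E) (mmul1x E). Qed.

End BasicEquations.

Lemma common_meadow_pre_meadow (M : commonMeadow) : pre_meadow M.
Proof.
have E := cm_eqs M; split=> // x y.
have z1 (u : M) : 0 * (1 + 0 * u) = 0 * u.
  by rewrite (mmulDr E) (mmulx1 E) (mmul0A E) (madd0x E).
have idem (u : M) : (0 * u) * (0 * u) = 0 * u.
  have := cm_mulV (1 + 0 * u); rewrite cm_inv1D z1 => /(congr1 (mul 0)).
  by rewrite (mmul0M E) !z1.
have sumE : (0 * x + 0 * y) + (0 * x) * (0 * y) = (0 * x) * (0 * y).
  have : 0 * ((1 + 0 * x) * (1 + 0 * y)) = (0 * x) * (0 * y).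
    by rewrite (mmul0M E) !z1.
  rewrite (mmulDl E 1) (mmul1x E) (mmulDr E (0 * x)) (mmulx1 E).
  rewrite !(mmulDr E 0) (mmulx1 E) (mmul0M E (0 * x)) !(mmul0A E) (madd0x E).
  by rewrite (maddC E (0 * x) (0 * y)) (maddA E).
have := idem (x + y).
rewrite (mmulDr E 0) (mmulDl E) !(mmulDr E (_ * _)) !idem.
rewrite (mmulC E (0 * y)) (maddC E (_ * _) (0 * y)) (maddACA E) => <-.
have abE : (0 * x) * (0 * y) + (0 * x) * (0 * y) = (0 * x) * (0 * y).
  by rewrite -(mmul0M E) -(mmulDl E) (maddx0 E).
by rewrite abE sumE -(mmul0M E) (mmulA E).
Qed.

(* The operations of the quotient do not depend on the representatives.      *)
Section WellDefined.
Variables (P : meadowSig) (hP : pre_meadow P) (I : set P) (hI : is_ideal I).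

Let E : meadow_eqs P := hP.1.

Lemma mmul0D (x y : P) : 0 * (x + y) = 0 * x * (0 * y).
Proof. by rewrite hP.2 -(mmul0M E) (mmulA E). Qed.

Lemma fiberD (z x y : P) : fiber z x -> fiber z y -> fiber z (x + y).
Proof.
rewrite /fiber /= => xz yz; rewrite (mmulDr E) xz yz -[in RHS]xz.
by rewrite -[in RHS](maddx0x E (0 * x)) (mmul0A E) xz.
Qed.

Lemma mmul0N (x : P) : 0 * - x = 0 * x.
Proof.
have xN : 0 * x + 0 * - x = 0 * x by rewrite -(mmulDr E) (maddN E) (mmul0A E).
have Nx : 0 * - x + 0 * x = 0 * - x.
  by rewrite -(mmulDr E) -[X in _ + X](moppK E x) (maddN E) (mmul0A E).
by rewrite -xN (maddC E) Nx.
Qed.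

Lemma mmulN1x (x : P) : opp 1 * x = - x.
Proof.
have x0 : 0 * (opp 1 * x) = 0 * x.
  by rewrite (mmul0M E) mmul0N -(mmul0M E) (mmul1x E).
have xD : opp 1 * x + x = 0 * x.
  rewrite -[X in _ + X](mmul1x E x) -(mmulDl E) (maddC E) (maddN E).
  by rewrite (mmulx1 E).
rewrite -[LHS](maddx0x E) x0 -(maddN E) -(maddA E) xD (maddC E) -mmul0N.
exact: maddx0x.
Qed.

Lemma moppD (x y : P) : - (x + y) = - x + - y.
Proof. by rewrite -(mmulN1x (x + y)) -(mmulN1x x) -(mmulN1x y) (mmulDr E). Qed.

Lemma fiberN (z x : P) : fiber z x -> fiber z (- x).
Proof. by rewrite /fiber /= mmul0N. Qed.

Lemma ideal_mul0 (x : P) : I (0 * x).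
Proof. exact/(idealM hI)/(ideal0 hI). Qed.

Lemma coset_refl (x : P) : coset I (0 * x) x x.
Proof.
exists (0 * x); last exact: maddx0x E x.
by split; [exact: ideal_mul0 | exact: (mmul0A E)].
Qed.

Lemma coset_shift (x i : P) : I i -> 0 * i = 0 * x ->
  coset I (0 * x) (x + i) = coset I (0 * x) x.
Proof.
move=> Ii ix; apply/seteqP; split=> _ [j [Ij jx] <-].
  exists (i + j); last by rewrite (maddA E).
  by split; [exact: (idealD hI) | exact: fiberD].
exists (- i + j).
  split; first exact: (idealD hI (idealN hI Ii) Ij).
  by apply: fiberD => //; apply: fiberN.
rewrite (maddA E) -(maddA E i) (maddN E) ix -(maddA E).
by rewrite (maddx0x E).
Qed.

Lemma rho_eq (x y : P) : 0 * x = 0 * y ->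
  coset I (0 * x) x = coset I (0 * y) y -> rho I x = rho I y.
Proof.
rewrite /rho.
case: pselect => hx; case: pselect => hy // xy Cxy.
- by rewrite xy in hx.
- by rewrite -xy in hy.
congr Some.
move: (conj _ _) (conj _ _) (ex_intro2 _ _ _ _ _) (ex_intro2 _ _ _ _ _).
move: (0 * x) (0 * y) (coset _ _ x) (coset _ _ y) xy Cxy.
move=> z z' C C' zz' CC'; subst z' C' => /= p p' q q'.
by rewrite (Prop_irrelevance p p') in q *; rewrite (Prop_irrelevance q q').
Qed.

Lemma rho_shift (x i : P) : I i -> 0 * i = 0 * x -> rho I (x + i) = rho I x.
Proof.
move=> Ii ix; have xi : 0 * (x + i) = 0 * x by exact: fiberD.
by apply: rho_eq => //; rewrite xi coset_shift.
Qed.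

Lemma rho_full (x : P) : full_zeros I (0 * x) -> rho I x = None.
Proof. by rewrite /rho; case: pselect. Qed.

(* The chosen representative of the class of x is x up to I.                 *)
Lemma rho_repr (x : P) : ~ full_zeros I (0 * x) ->
  exists zC i, [/\ rho I x = Some zC, I i, 0 * i = 0 * x
                 & repr (projT2 zC) = x + i].
Proof.
rewrite {1}/rho; case: pselect => // h _.
set zC := existT _ _ _; exists zC.
have : coset I (0 * x) x (repr (projT2 zC)).
  rewrite /repr /=; case: cid2 => y /= xy <-.
  by rewrite -[in X in coset _ X]xy; exact: coset_refl.
by move=> [i [Ii ix] xi]; exists i.
Qed.

Lemma addq_rho (x y : P) :
  ~ full_zeros I (0 * x) -> ~ full_zeros I (0 * y) ->
  addq (rho I x) (rho I y) = rho I (x + y).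
Proof.
move=> /rho_repr[[z C] [i [-> Ii ix /= Ci]]].
move=> /rho_repr[[z' D] [j [-> Ij jy /= Dj]]].
rewrite Ci Dj (maddACA E); apply: rho_shift; first exact: (idealD hI).
by rewrite !mmul0D ix jy.
Qed.

Lemma mulq_rho (x y : P) :
  ~ full_zeros I (0 * x) -> ~ full_zeros I (0 * y) ->
  mulq (rho I x) (rho I y) = rho I (x * y).
Proof.
move=> /rho_repr[[z C] [i [-> Ii ix /= Ci]]].
move=> /rho_repr[[z' D] [j [-> Ij jy /= Dj]]].
rewrite Ci Dj (mmulDl E) !(mmulDr E) (maddA E).
have Hx r : I (r * j) by rewrite (mmulC E); exact: (idealM hI).
have Hy r : I (i * r) by exact: (idealM hI).
have Fx : fiber (0 * (x * y)) (x * j) by rewrite /fiber /= !(mmul0M E) jy.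
have Fy : fiber (0 * (x * y)) (i * y) by rewrite /fiber /= !(mmul0M E) ix.
have Fz : fiber (0 * (x * y)) (i * j) by rewrite /fiber /= !(mmul0M E) ix jy.
apply: rho_shift.
  exact: (idealD hI (Hx _) (idealD hI (Hy _) (Hy _))).
exact: (fiberD Fx (fiberD Fy Fz)).
Qed.

Lemma oppq_rho (x : P) : ~ full_zeros I (0 * x) ->
  oppq (rho I x) = rho I (- x).
Proof.
move=> /rho_repr[[z C] [i [-> Ii ix /= ->]]]; rewrite moppD.
by apply: rho_shift; [exact: (idealN hI) | rewrite !mmul0N].
Qed.

End WellDefined.

(* Main.v *)
Require Import Defs.
From mathcomp Require Import all_boot.
From mathcomp Require Import boolp classical_sets.

Set Implicit Arguments.
Unset Strict Implicit.

(** The fibre over z lies in I exactly when 1 + z does, so full zeros absorb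
    products, and rho is additive and multiplicative also where it takes the
    value a.  As rho sends the absorbing element of M to a, it is onto, and
    every equation of M passes to M/I.  For the universal property, f maps the
    elements u of a full fibre to elements of N over a zero e = 0 * f u with
    1 + e = e; inverting, e = (1 + e)^-1 = e^-1 = 0^-1 * (f u)^-1 = a. *)

Local Open Scope classical_set_scope.
Local Open Scope meadow_scope.

(** * Absorption laws in a common meadow *)

Section CommonMeadowTheory.
Variable M : commonMeadow.

Let E : meadow_eqs M := cm_eqs M.
Let hM : pre_meadow M := common_meadow_pre_meadow M.

Lemma mul0bot : 0 * bot M = bot M.
Proof. by rewrite -(maddN E) (maddC E) cm_addbot. Qed.

(** The law 0 * (x + y) = 0 * x * y turns additive absorption into multiplicative absorption. *)
Lemma mulbotx (x : M) : bot M * x = bot M.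
Proof. by rewrite -[in LHS]mul0bot -hM.2 (maddC E) cm_addbot mul0bot. Qed.

Lemma mul0_eq_bot (x : M) : 0 * x = bot M -> x = bot M.
Proof. by move=> xb; rewrite -(maddx0x E x) xb cm_addbot. Qed.

Lemma unit_eq_zero_bot (x : M) : 1 + 0 * x = 0 * x -> x = bot M.
Proof.
move=> xE; apply: mul0_eq_bot; rewrite -xE -cm_inv1D xE.
by rewrite cm_invM cm_inv0 mulbotx.
Qed.

Lemma mul0_unit (x : M) : 0 * (1 + 0 * x) = 0 * x.
Proof. by rewrite (mmulDr E) (mmulx1 E) (mmul0A E) (madd0x E). Qed.

(** Apply [mmul0D] to the sum x + 0 * x, which equals x. *)
Lemma mul0_idem (x : M) : (0 * x) * (0 * x) = 0 * x.
Proof. by have := mmul0D hM x (0 * x); rewrite (maddx0x E) (mmul0A E). Qed.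

Lemma mul0_absorb (x y : M) : 0 * (x * (x * y)) = 0 * (x * y).
Proof. by rewrite !(mmul0M E) -(mmulA E) mul0_idem. Qed.

Lemma unit_absorb (x y : M) : 0 * (x * y) = 0 * y -> (1 + 0 * x) * y = y.
Proof.
by move=> xy; rewrite (mmulDl E) (mmul1x E) (mmulA E) xy (maddx0x E).
Qed.

End CommonMeadowTheory.

Lemma hom0 (M N : commonMeadow) (f : M -> N) : is_hom f -> f 0 = 0.
Proof.
case=> fD _ f1; have EN := cm_eqs N.
have f01 : 1 + f 0 = 1 by rewrite -f1 -fD (maddx0 (cm_eqs M)).
(* Sums in N do not cancel in general, but 1 does, because 0 * 1 = 0. *)
have one_opp : (1 : N) + opp 1 = 0 by rewrite (maddN EN) (mmulx1 EN).
by rewrite -(maddx0 EN (f 0)) -one_opp -(maddA EN) (maddC EN (f 0)) f01.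
Qed.

(** * The quotient map and the fibres of the quotient *)

Section QuotientTheory.
Variables (M : commonMeadow) (I : set M) (hI : is_ideal I).

Let E : meadow_eqs M := cm_eqs M.
Let hM : pre_meadow M := common_meadow_pre_meadow M.

(** 1 + 0 * x is the identity of its fibre ring, so an ideal containing it contains the whole
    fibre. *)
Lemma full_zerosP (x : M) : full_zeros I (0 * x) <-> I (1 + 0 * x).
Proof.
split=> [[_ IxE]|Iu].
  have : fiber (0 * x) (1 + 0 * x) by exact: mul0_unit.
  by rewrite -IxE => -[].
split; first exact: imageT.
apply/seteqP; split=> [y []|y yx] //; split=> //.
rewrite -(unit_absorb (x := x) (y := y)); first exact: (idealM hI).
by rewrite (mmul0M E) yx mul0_idem.
Qed.

Lemma full_zerosMl (x y : M) :
  full_zeros I (0 * x) -> full_zeros I (0 * (x * y)).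
Proof.
move=> /full_zerosP Ix; apply/full_zerosP.
rewrite -(unit_absorb (x := x) (y := 1 + _)); first exact: (idealM hI).
by rewrite (mmul0M E) mul0_unit -(mmul0M E) mul0_absorb.
Qed.

Lemma full_zerosMr (x y : M) :
  full_zeros I (0 * y) -> full_zeros I (0 * (x * y)).
Proof. by rewrite (mmulC E x); exact: full_zerosMl. Qed.

Lemma full_zeros_bot : full_zeros I (0 * bot M).
Proof.
apply/full_zerosP; rewrite mul0bot cm_addbot -mul0bot.
exact: (ideal_mul0 hI).
Qed.

Lemma addqr_none (u : quotient_sort I) : addq u None = None.
Proof. by case: u => // -[]. Qed.

Lemma mulqr_none (u : quotient_sort I) : mulq u None = None.
Proof. by case: u => // -[]. Qed.

Lemma rho_bot : rho I (bot M) = None.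
Proof. exact/rho_full/full_zeros_bot. Qed.

Lemma rhoM (x y : M) : rho I (x * y) = mulq (rho I x) (rho I y).
Proof.
have [Kx|Kx] := pselect (full_zeros I (0 * x)).
  by rewrite (rho_full Kx) rho_full //; exact: full_zerosMl.
have [Ky|Ky] := pselect (full_zeros I (0 * y)).
  by rewrite (rho_full Ky) mulqr_none rho_full //; exact: full_zerosMr.
by rewrite mulq_rho.
Qed.

Lemma rhoD (x y : M) : rho I (x + y) = addq (rho I x) (rho I y).
Proof.
have xyE : 0 * (x + y) = 0 * (x * y) by rewrite (mmul0D hM) (mmul0M E).
have [Kx|Kx] := pselect (full_zeros I (0 * x)).
  by rewrite (rho_full Kx) rho_full // xyE; exact: full_zerosMl.
have [Ky|Ky] := pselect (full_zeros I (0 * y)).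
  by rewrite (rho_full Ky) addqr_none rho_full // xyE; exact: full_zerosMr.
by rewrite addq_rho.
Qed.

Lemma rhoN (x : M) : rho I (- x) = oppq (rho I x).
Proof.
have [Kx|Kx] := pselect (full_zeros I (0 * x)); last by rewrite oppq_rho.
by rewrite (rho_full Kx) rho_full // (mmul0N hM).
Qed.

Lemma rho_is_hom : is_hom (rho I : M -> quotient I).
Proof. by split=> // x y; rewrite ?rhoD ?rhoM. Qed.

(** Allows each element of the quotient to be replaced by some [rho I x], so that no chosen
    representative has to be handled. *)
Lemma rho_surj (u : quotient I) : exists x, rho I x = u.
Proof.
case: u => [[[z p] [C q]]|]; last by exists (bot M); exact: rho_bot.
have [x xz CE] := q; exists x; rewrite /fiber /= in xz CE.
subst z C; rewrite /rho; case: pselect => [/p.2//|zNK]; congr Some.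
move: (conj _ _) (ex_intro2 _ _ _ _ _) => /= p' q'.
(* The two dependent pairs now differ only in their membership proofs. *)
by rewrite (Prop_irrelevance p p') in q *; rewrite (Prop_irrelevance q q').
Qed.

Lemma rho_none (x : M) : rho I x = None -> full_zeros I (0 * x).
Proof.
by move=> xN; apply: contrapT => /(rho_repr hM hI)[zC [i []]]; rewrite xN.
Qed.

(** Equal classes share one chosen representative, which is x + i and also y + j. *)
Lemma rho_inj (x y : M) : ~ full_zeros I (0 * x) -> rho I x = rho I y ->
  exists i j, [/\ I i, I j, 0 * i = 0 * x, 0 * j = 0 * y & x + i = y + j].
Proof.
move=> Kx xy; have Ky : ~ full_zeros I (0 * y).
  by move=> /rho_full yN; apply: Kx; apply: rho_none; rewrite xy.
have [zC [i [xC Ii ix Ci]]] := rho_repr hM hI Kx.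
have [zD [j [yD Ij jy Dj]]] := rho_repr hM hI Ky.
exists i, j; split=> //; rewrite -Ci -Dj.
by move: yD; rewrite -xy xC => -[->].
Qed.

Lemma quotient_pre_meadow : pre_meadow (quotient I).
Proof.
split.
  split; rewrite /= => *;
  repeat match goal with u : quotient_sort I |- _ =>
    have [? <-] := rho_surj u; clear u end;
  rewrite -?(rhoN, rhoD, rhoM); congr rho.
  - exact: maddA.
  - exact: maddC.
  - exact: maddx0.
  - exact: maddN.
  - exact: mmulA.
  - exact: mmulC.
  - exact: mmul1x.
  - exact: mmulDr.
  - exact: moppK.
move=> u v; have [x <-] := rho_surj u; have [y <-] := rho_surj v.
by rewrite /= -!(rhoD, rhoM) hM.2.
Qed.

Lemma quotient_fiber_a : fiber (quotient_a I) = [set quotient_a I].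
Proof.
apply/seteqP; split=> u; last by move=> ->; exact: mulqr_none.
have [x <-] := rho_surj u; rewrite /fiber /= -rhoM => /rho_none.
by rewrite (mmul0A E); exact: rho_full.
Qed.

Lemma quotient_with_a : pre_meadow_with_a (quotient_a I).
Proof.
split; [exact: quotient_pre_meadow | split | exact: addqr_none].
  split; last by exists (quotient_a I); exact: quotient_fiber_a.
  by exists (quotient_a I); [|exact: mulqr_none].
move=> _ [[u _ <-] [w fw]]; have [x xu] := rho_surj u; subst u.
apply: contrapT => Nx; have Kx : ~ full_zeros I (0 * x).
  by move=> /rho_full Kx; apply: Nx; rewrite Kx /=; exact/esym/mulqr_none.
(* If w is the only element of the fibre, the zero and the identity of that fibre both equal w. *)
have zw : rho I (0 * x) = w.
  have : fiber (0 * (rho I x : quotient I)) (rho I (0 * x)).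
    by rewrite /fiber /= -!rhoM (mmul0A E).
  by rewrite fw.
have : rho I (1 + 0 * x) = w.
  have : fiber (0 * (rho I x : quotient I)) (rho I (1 + 0 * x)).
    by rewrite /fiber /= -!rhoM mul0_unit.
  by rewrite fw.
rewrite -zw => /rho_inj; rewrite mul0_unit => /(_ Kx)[i [j [Ii Ij ix]]].
rewrite (mmul0A E) => jx eq_ij; apply: Kx; apply/full_zerosP.
(* By [eq_ij] this is j - i, an element of I, so the fibre of x would be full. *)
have -> : 1 + 0 * x = (1 + 0 * x) + i + - i.
  by rewrite (maddA E _ i) (maddN E) ix -[LHS](maddx0x E) mul0_unit.
rewrite eq_ij -jx (maddC E (0 * j)) (maddx0x E).
exact: (idealD hI Ij (idealN hI Ii)).
Qed.

(** * The universal property *)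

Section UniversalProperty.
Variables (N : commonMeadow) (f : M -> N) (fH : is_hom f).
Hypothesis fI : forall x, I x -> 0 * f x = f x.

Let EN : meadow_eqs N := cm_eqs N.

Lemma hom_mul0 (x : M) : f (0 * x) = 0 * f x.
Proof. by case: (fH) => _ -> _; rewrite (hom0 fH). Qed.

Lemma hom_full (x : M) : full_zeros I (0 * x) -> f x = bot N.
Proof.
move=> /full_zerosP /fI; case: (fH) => fD fM f1.
by rewrite fD f1 hom_mul0 mul0_unit => /esym; exact: unit_eq_zero_bot.
Qed.

(** Here f i = 0 * f i = f (0 * i) = 0 * f x, the zero of the fibre of f x. *)
Lemma hom_shift (x i : M) : I i -> 0 * i = 0 * x -> f (x + i) = f x.
Proof.
move=> /fI fi ix; case: (fH) => fD _ _.
by rewrite fD -fi -hom_mul0 ix hom_mul0 (maddx0x EN).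
Qed.

Lemma hom_rho_eq (x y : M) : rho I x = rho I y -> f x = f y.
Proof.
move=> xy; have [Kx|Kx] := pselect (full_zeros I (0 * x)).
  rewrite !hom_full //; apply: rho_none; rewrite -xy; exact: rho_full.
have [i [j [Ii Ij ix jy ij]]] := rho_inj Kx xy.
by rewrite -(hom_shift Ii ix) ij hom_shift.
Qed.

Lemma quotient_lift : exists! g : quotient I -> N,
  is_hom g /\ g \o (rho I : M -> quotient I) = f.
Proof.
(* An arbitrary preimage under [rho] is chosen; by [hom_rho_eq] the value of f does not depend on
   it. *)
pose g (u : quotient I) : N := f (sval (cid (rho_surj u))).
have gE x : g (rho I x) = f x.
  by rewrite /g; case: cid => y /=; exact: hom_rho_eq.
have [fD fM f1] := fH.
exists g; split=> [|h [_ hf]].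
  split; last by apply/funext.
  split=> [u v|u v|]; last by rewrite gE.
    have [x <-] := rho_surj u; have [y <-] := rho_surj v.
    by rewrite /= -rhoD !gE fD.
  have [x <-] := rho_surj u; have [y <-] := rho_surj v.
  by rewrite /= -rhoM !gE fM.
by apply/funext => u; have [x <-] := rho_surj u; rewrite gE -hf.
Qed.

End UniversalProperty.

End QuotientTheory.

Theorem theorem4p13 (M : commonMeadow) (I : set M) (hI : is_ideal I)
    (I_proper : I <> [set: M]) :
  pre_meadow_with_a (quotient_a I) /\
  is_hom (rho I : M -> quotient I) /\
  (forall (N : commonMeadow) (f : M -> N),
      is_hom f -> (forall x : M, I x -> 0 * f x = f x) ->
      exists! g : quotient I -> N,
        is_hom g /\ g \o (rho I : M -> quotient I) = f).
Proof.
split; first exact: quotient_with_a.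
split; first exact: rho_is_hom.
by move=> N f; exact: quotient_lift.
Qed.
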